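(* Let $f:\mathbb{R}^d\to\mathbb{R}$ be continuously differentiable, let $\mu,L>0$, and let $x^\ast\in\mathbb{R}^d$ be a $(\mu,L)$-regular point of $f$. Let $\alpha>0$ and let $(x_t,v_t)_{t\ge 0}$ be a solution of the heavy ball ODE $$\dot x_t=v_t,\qquad \dot v_t=-\alpha v_t-\nabla f(x_t)$$ with initial condition $x_0,v_0\in\mathbb{R}^d$. Define $$m(\alpha)=\tfrac12\Bigl(\alpha-\sqrt{\max(0,\alpha^2-4\mu)}\Bigr).$$ If $(x_t,v_t)\to(x^\ast,0)$ as $t\to\infty$, then for every $\varepsilon>0$ one has $$\lim_{t\to\infty}e^{(m(\alpha)-\varepsilon)t}\,\|x_t-x^\ast\|=0$$ and $$\lim_{t\to\infty}e^{2(m(\alpha)-\varepsilon)t}\,(f(x_t)-f(x^\ast))=0.$$ In particular, $m(\alpha)$ is maximized over $\alpha>0$ by $\alpha^\ast=2\sqrt{\mu}$, for which $m(\alpha^\ast)=\sqrt{\mu}$.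
   Context: $\|\cdot\|$ is the Euclidean norm. Let $f:\mathbb{R}^d\to\mathbb{R}$ be continuously differentiable and $\mu,L>0$. A critical point $x^\ast$ of $f$ that is a local minimum is called a $(\mu,L)$-regular point of $f$ if there is an open neighborhood $U\subset\mathbb{R}^d$ of $x^\ast$ such that: (A1) $f|_U$ is four times continuously differentiable; (A2) $\|\nabla f(x)\|^2\ge 2\mu(f(x)-f(x^\ast))$ for all $x\in U$ (Polyak-Lojasiewicz inequality); (A3) $\|\nabla f(x)-\nabla f(y)\|\le L\|x-y\|$ for all $x,y\in U$. *)

(* Defs.v *)
From mathcomp Require Import all_boot all_order all_algebra.
From mathcomp Require Import all_classical all_reals all_analysis.

Set Implicit Arguments.
Unset Strict Implicit.
Unset Printing Implicit Defensive.

Import Order.TTheory GRing.Theory Num.Theory.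
Import numFieldNormedType.Exports.

Local Open Scope classical_set_scope.
Local Open Scope ring_scope.

(* The library norm on ['rV[R]_d] is the sup norm; it induces the same topology
   (hence the same limits and derivatives) as the Euclidean norm [enorm], but
   metric inequalities must use [enorm]. *)
Definition enorm (R : realType) (d : nat) (u : 'rV[R]_d) : R :=
  Num.sqrt (\sum_(i < d) u ord0 i ^+ 2).

Definition partial (R : realType) (d : nat) (i : 'I_d) (f : 'rV[R]_d -> R)
  (x : 'rV[R]_d) : R := 'D_(delta_mx ord0 i) f x.

Definition grad (R : realType) (d : nat) (f : 'rV[R]_d -> R) (x : 'rV[R]_d) :
  'rV[R]_d := \row_(i < d) partial i f x.

(* [f] is [k] times continuously differentiable on [U]. Differentiability is
   taken in the ambient space, so this is meant for open [U] only. *)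
Fixpoint Ck_on (R : realType) (d : nat) (k : nat) (U : set 'rV[R]_d)
    (f : 'rV[R]_d -> R) {struct k} : Prop :=
  match k with
  | 0%N => forall x, U x -> {for x, continuous f}
  | k'.+1 => (forall x, U x -> differentiable f x) /\
             (forall i : 'I_d, Ck_on k' U (partial i f))
  end.

Definition regular_point (R : realType) (d : nat) (mu L : R)
    (f : 'rV[R]_d -> R) (xs : 'rV[R]_d) : Prop :=
  [/\ grad f xs = 0,
      (\forall y \near xs, f xs <= f y) &
      exists U : set 'rV[R]_d,
        [/\ open U /\ U xs,
            Ck_on 4 U f,
            (forall x, U x ->
               2 * mu * (f x - f xs) <= enorm (grad f x) ^+ 2) &
            (forall x y, U x -> U y ->
               enorm (grad f x - grad f y) <= L * enorm (x - y))]].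

(* Only the values at times [t >= 0] matter; the derivative at time 0 is
   one-sided. *)
Definition has_derivative_on_halfline (R : realType) (d : nat)
    (y dy : R -> 'rV[R]_d) : Prop :=
  (forall t : R, 0 < t -> is_derive t 1 y (dy t)) /\
  (h^-1 *: (y h - y 0) @[h --> 0^'+] --> dy 0).

Definition heavy_ball_solution (R : realType) (d : nat) (alpha : R)
    (f : 'rV[R]_d -> R) (x0 v0 : 'rV[R]_d) (x v : R -> 'rV[R]_d) : Prop :=
  [/\ x 0 = x0, v 0 = v0,
      has_derivative_on_halfline x v &
      has_derivative_on_halfline v (fun t => - (alpha *: v t) - grad f (x t))].

Definition hb_rate (R : realType) (mu alpha : R) : R :=
  2^-1 * (alpha - Num.sqrt (Num.max 0 (alpha ^+ 2 - 4 * mu))).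

(* Main.v *)
Require Import Defs.
From mathcomp Require Import all_boot all_order all_algebra.
From mathcomp Require Import all_classical all_reals all_analysis.
From mathcomp Require Import ring lra.

Set Implicit Arguments.
Unset Strict Implicit.
Unset Printing Implicit Defensive.

Import Order.TTheory GRing.Theory Num.Theory.
Import numFieldNormedType.Exports.

Local Open Scope classical_set_scope.
Local Open Scope ring_scope.

(** Write a for the minimum, H for the Hessian of f at a and g_t for the gradient
    of f at x_t. The difficulty is that H may be degenerate: the minimum need not
    be isolated, and no restoring force damps the component of x_t - a along the
    set of minimisers. The proof works with the pair (g_t, v_t) instead,
    which solves a system that is asymptotically linear,
<<
      g' = v H + o(v),        v' = - alpha v - g,
>>
    because the Hessian at x_t tends to H ([is_derive_grad], [hess_near]).

    On the kernel of H this linear system does not damp g at all, so something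
    must keep g away from that kernel: this is what the Polyak-Lojasiewicz
    inequality does. At second order it says H^2 >= mu H ([pl_hess]), hence
    H^3 >= mu H^2, that is H >= mu on the range of H ([pl_range_gap]). Moreover
    gradients near a almost lie in that range: minimising the penalised function
    f + c |. - x|^2 yields a point p with gradient 2 c (x - p), small with respect
    to the gradient at x by the inequality at x, so the gradient at x is
    (x - p) H up to a small relative error. The outcome is [grad_hess_gap]: for
    each delta, <g H, g> >= (mu - delta) |g|^2 for all gradients g at points near a.

    For 0 < r < m(alpha) one has 2 r <= alpha and r^2 - alpha r + mu > 0
    ([lt_hb_rate]). For a scalar oscillator z'' = - alpha z' - lambda z with
    lambda >= mu, the function u = e^(r t) z then satisfies
    u'' + (alpha - 2 r) u' + (lambda - alpha r + r^2) u = 0 with nonnegative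
    coefficients, so its energy u'^2 + (lambda - alpha r + r^2) u^2 does not
    increase. Undoing the substitution, with g in the place of z and v H in the
    place of z', gives [energy]; a small multiple of |v|^2 is added to control the
    kernel component of v, and the gap r < m(alpha) absorbs all error terms
    ([energy_decay]). Gronwall's lemma gives |v_t| = O(e^(- k t)) for every
    k < m(alpha) ([velocity_decay]); integrating the velocity from t to infinity,
    the same holds for x_t - a ([position_decay]), and f - f(a) is bounded by a
    multiple of |x - a|^2 ([quadratic_upper_bound]). *)

(** * Euclidean inner product on row vectors *)

Section InnerProduct.
Context {R : realType} {d : nat}.
Implicit Types (u v w : 'rV[R]_d) (A : 'M[R]_d).

Definition dot u v : R := \sum_(i < d) u ord0 i * v ord0 i.

Lemma dotC u v : dot u v = dot v u.
Proof. by apply: eq_bigr => i _; rewrite mulrC. Qed.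

Lemma dotDl u v w : dot (u + v) w = dot u w + dot v w.
Proof. by rewrite -big_split; apply: eq_bigr => i _; rewrite mxE mulrDl. Qed.

Lemma dotZl (k : R) u v : dot (k *: u) v = k * dot u v.
Proof. by rewrite mulr_sumr; apply: eq_bigr => i _; rewrite mxE mulrA. Qed.

Lemma dotNl u v : dot (- u) v = - dot u v.
Proof. by rewrite -scaleN1r dotZl mulN1r. Qed.

Lemma dotDr u v w : dot u (v + w) = dot u v + dot u w.
Proof. by rewrite dotC dotDl ![dot _ u]dotC. Qed.

Lemma dotZr (k : R) u v : dot u (k *: v) = k * dot u v.
Proof. by rewrite dotC dotZl dotC. Qed.

Lemma dotNr u v : dot u (- v) = - dot u v.
Proof. by rewrite dotC dotNl dotC. Qed.

Lemma dot0l u : dot 0 u = 0.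
Proof. by rewrite -(scale0r 0) dotZl mul0r. Qed.

Definition dotE := (dotDl, dotDr, dotNl, dotNr, dotZl, dotZr).

Lemma dot_mulmxA u v A : dot (u *m A) v = dot u (v *m A^T).
Proof.
rewrite /dot (eq_bigr (fun i => \sum_j u ord0 j * A j i * v ord0 i)); last first.
  by move=> i _; rewrite mxE mulr_suml.
rewrite exchange_big; apply: eq_bigr => j _; rewrite mxE mulr_sumr.
by apply: eq_bigr => i _; rewrite mxE -mulrA [A j i * _]mulrC.
Qed.

Lemma dot_ge0 u : 0 <= dot u u.
Proof. by apply: sumr_ge0 => i _; rewrite -expr2 sqr_ge0. Qed.

Lemma dot_eq0 u : dot u u = 0 -> u = 0.
Proof.
move=> u0; apply/rowP => i; rewrite mxE; apply/eqP.
rewrite -[_ == 0]orbb -mulf_eq0; apply/eqP.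
apply: (psumr_eq0P _ u0) => // j _; rewrite -expr2; exact: sqr_ge0.
Qed.

Lemma sqr_coord_le_dot u i : u ord0 i ^+ 2 <= dot u u.
Proof.
rewrite /dot (bigD1 i) //= -expr2 lerDl.
by apply: sumr_ge0 => j _; rewrite -expr2 sqr_ge0.
Qed.

Lemma enormE u : enorm u = Num.sqrt (dot u u).
Proof. by congr Num.sqrt; apply: eq_bigr => i _; rewrite expr2. Qed.

Lemma enorm_sqr u : enorm u ^+ 2 = dot u u.
Proof. by rewrite enormE sqr_sqrtr ?dot_ge0. Qed.

Lemma enorm_ge0 u : 0 <= enorm u.
Proof. exact: sqrtr_ge0. Qed.

(** Young's inequality, from |a u - v|^2 >= 0. Error terms are absorbed through
    it, which avoids square roots. *)
Lemma dot_young (a : R) u v : 0 < a ->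
  2 * dot u v <= a * dot u u + a^-1 * dot v v.
Proof.
move=> a0; have := dot_ge0 (a *: u - v); rewrite !dotE (dotC v u) => h.
have : 0 <= a^-1 * (a * (a * dot u u) - a * dot u v - (a * dot u v - dot v v)).
  by apply: mulr_ge0; [rewrite invr_ge0 ltW|move: h; lra].
have -> : a^-1 * (a * (a * dot u u) - a * dot u v - (a * dot u v - dot v v)) =
  a * dot u u + a^-1 * dot v v - 2 * dot u v by field; rewrite gt_eqF.
by rewrite subr_ge0.
Qed.

Lemma cauchy_schwarz u v : dot u v ^+ 2 <= dot u u * dot v v.
Proof.
have [v0|vN0] := eqVneq (dot v v) 0.
  by rewrite (dot_eq0 v0) dotC !dot0l expr0n /= mulr0.
have v_gt0 : 0 < dot v v by rewrite lt_def vN0 dot_ge0.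
have := dot_ge0 (dot v v *: u - dot u v *: v); rewrite !dotE (dotC v u) => h.
rewrite -subr_ge0 -(pmulr_rge0 _ v_gt0); move: h; lra.
Qed.

(** The squared Frobenius norm, used as a bound for the squared operator norm. *)
Definition fro2 A : R := \sum_i \sum_j A i j ^+ 2.

Lemma fro2_ge0 A : 0 <= fro2 A.
Proof. by do 2!(apply: sumr_ge0 => ? _); exact: sqr_ge0. Qed.

Lemma dot_mulmx_le u A : dot (u *m A) (u *m A) <= fro2 A * dot u u.
Proof.
rewrite /fro2 exchange_big /= mulr_suml; apply: ler_sum => i _.
rewrite -expr2 mxE mulrC.
pose a : 'rV[R]_d := \row_j A j i.
have -> : \sum_j u ord0 j * A j i = dot u a.
  by apply: eq_bigr => j _; rewrite mxE.
have -> : \sum_j A j i ^+ 2 = dot a a.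
  by apply: eq_bigr => j _; rewrite mxE expr2.
exact: cauchy_schwarz.
Qed.

Lemma dot_mulmx_norm_le A u v :
  2 * dot (u *m A) v <= fro2 A * dot u u + dot v v.
Proof.
have := dot_young (u *m A) v ltr01; rewrite invr1 !mul1r => h.
by apply: le_trans h _; rewrite lerD2r dot_mulmx_le.
Qed.

Lemma dotDD_le u v : dot (u + v) (u + v) <= 2 * (dot u u + dot v v).
Proof. by have := dot_ge0 (u - v); rewrite !dotE (dotC v u); lra. Qed.

Lemma norm_le_dot u : `|u| ^+ 2 <= dot u u.
Proof.
have [->|u0] := eqVneq u 0; first by rewrite normr0 expr0n /= dot_ge0.
have /mx_norm_neq0[[i j] /=] : mx_norm u != 0.
  by apply: contraNneq u0 => /mx_norm_eq0 ->.
rewrite [`|u|]/Num.Def.normr/= => ->; rewrite ord1 /=.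
by rewrite real_normK ?num_real// sqr_coord_le_dot.
Qed.

End InnerProduct.

(** * Inequalities and derivatives in one variable *)

Section RealLemmas.
Context {R : realType}.

Lemma sqr_le_norm (x y : R) : 0 <= y -> x ^+ 2 <= y ^+ 2 -> `|x| <= y.
Proof. by move=> y0; rewrite -(real_normK (num_real x)) ler_sqr ?nnegrE. Qed.

(** This is how the limit of a small step is taken below: a homogeneous inequality
    that holds up to s C for every small s holds exactly. *)
Lemma le0_of_small_multiples (x C : R) :
  (forall s, 0 < s <= 1 -> x <= s * C) -> x <= 0.
Proof.
move=> H; rewrite leNgt; apply/negP => x0.
have xC : x <= C by rewrite -[C]mul1r H// ltr01 lexx.
have C0 : 0 < C by exact: lt_le_trans xC.
have : x <= x / (2 * C) * C.
  apply: H; rewrite divr_gt0 ?mulr_gt0//= ler_pdivrMr ?mulr_gt0// mul1r.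
  by lra.
have -> : x / (2 * C) * C = x / 2 by field; rewrite gt_eqF.
lra.
Qed.

Lemma is_derive_quadratic (A B D s : R) :
  is_derive s 1 (fun t : R => A + B * t + D * t ^+ 2) (B + 2 * D * s).
Proof.
have dB : is_derive s 1 (fun t : R => B * t) B.
  by have := is_deriveZ B (is_derive_id s (1 : R)); rewrite [_ *: 1]mulr1.
have dD : is_derive s 1 (fun t : R => D * t ^+ 2) (2 * D * s).
  have := is_deriveZ D (is_deriveX 2 (is_derive_id s (1 : R))).
  have -> // : D *: ((2 * s ^+ 1) *: (1 : R)) = 2 * D * s.
  by rewrite /GRing.scale/= expr1; ring.
have := is_deriveD (is_deriveD (is_derive_cst A s (1 : R)) dB) dD.
by rewrite add0r.
Qed.

Lemma mvt01 (phi dphi : R -> R) :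
  (forall s : R, 0 <= s <= 1 -> is_derive s 1 phi (dphi s)) ->
  exists2 s, 0 <= s <= 1 & phi 1 - phi 0 = dphi s.
Proof.
move=> dp; have [||s] := @MVT R phi dphi 0 1 ltr01.
- by move=> s; rewrite in_itv /= => /andP[s0 s1]; apply: dp; rewrite !ltW.
- apply: derivable_within_continuous => s; rewrite in_itv /= => s01.
  by have [] := dp s s01.
- rewrite in_itv /= subr0 mulr1 => /andP[s0 s1] e.
  by exists s => //; rewrite !ltW.
Qed.

End RealLemmas.

(** * First-order calculus on row vectors *)

Section Calculus.
Context {R : realType} {d : nat}.
Implicit Types (h f : 'rV[R]_d -> R) (a p u v x : 'rV[R]_d) (U : set 'rV[R]_d).

(** The index order makes [u *m hess f x] the derivative of the gradient in the
    direction u; symmetry is a theorem, [hess_sym]. *)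
Definition hess f x : 'M[R]_d := \matrix_(j, i) partial j (partial i f) x.

Lemma near_radius a (P : 'rV[R]_d -> Prop) : (\forall x \near a, P x) ->
  exists2 rho, 0 < rho & forall x, `|x - a| < rho -> P x.
Proof.
move=> /nbhs_normP[rho rho0 aP]; exists rho => // x xa.
by apply: aP; rewrite /ball_ /= distrC.
Qed.

Lemma exists_small_scale u (rho : R) : 0 < rho -> 
  exists2 k : R, 0 < k & `|k *: u| < rho.
Proof.
move=> rho0; have u1 : 0 < `|u| + 1 by rewrite ltr_wpDl.
exists (rho / (`|u| + 1)); first by rewrite divr_gt0.
rewrite normrZ ger0_norm ?divr_ge0 1?ltW// mulrAC ltr_pdivrMr// ltr_pM2l//.
by rewrite ltrDl.
Qed.

Lemma line_in_ball a p u (r s : R) : `|p - a| < r -> `|p + u - a| < r ->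
  0 <= s <= 1 -> `|p + s *: u - a| < r.
Proof.
move=> pa ua /andP[s0 s1].
have -> : p + s *: u - a = (1 - s) *: (p - a) + s *: (p + u - a).
  by apply/rowP => i; rewrite !mxE; ring.
apply: (le_lt_trans (ler_normD _ _)); rewrite !normrZ.
rewrite (ger0_norm s0) ger0_norm ?subr_ge0//.
have [->|sN0] := eqVneq s 0; first by rewrite mul0r subr0 mul1r addr0.
have {}s0 : 0 < s by rewrite lt_def sN0.
have -> : r = (1 - s) * r + s * r by ring.
by rewrite ler_ltD// ?ltr_pM2l// ler_wpM2l ?subr_ge0// ltW.
Qed.

Lemma diff_grad h x u : differentiable h x -> 'd h x u = dot u (grad h x).
Proof.
move=> dh; rewrite [in LHS](row_sum_delta u) linear_sum; apply: eq_bigr => i _.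
by rewrite linearZ /= mxE /partial deriveE.
Qed.

Lemma is_derive_line h p u (s : R) : differentiable h (p + s *: u) ->
  is_derive s 1 (fun r : R => h (p + r *: u)) (dot u (grad h (p + s *: u))).
Proof.
move=> dh.
have dl : is_diff s (fun r : R => p + r *: u) ( *:%R^~ u).
  have h1 := is_diffD (is_diff_cst p s) (is_diff_scalel s u).
  by rewrite add0r in h1.
have dd : differentiable (fun r : R => p + r *: u) s by case: dl.
have dc := differentiable_comp dd dh.
apply: DeriveDef; first exact: diff_derivable.
rewrite (deriveE _ dc) (diff_comp dd dh) /= diff_val scale1r.
exact: diff_grad.
Qed.

Lemma mvt_line h p u :
  (forall s : R, 0 <= s <= 1 -> differentiable h (p + s *: u)) ->
  exists2 s : R, 0 <= s <= 1 & h (p + u) - h p = dot u (grad h (p + s *: u)).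
Proof.
move=> dh.
have [s s01] := mvt01 (fun s s01 => is_derive_line (dh s s01)).
by rewrite scale1r scale0r addr0 => ?; exists s.
Qed.

Lemma C1_partial_near U h a (e : R) : open U -> U a -> Ck_on 1 U h -> 0 < e ->
  \forall x \near a, U x /\ dot (grad h x - grad h a) (grad h x - grad h a) < e.
Proof.
move=> oU Ua [dh ch] e0.
pose e' := e / (d%:R + 1).
have e'0 : 0 < e' by rewrite divr_gt0// ltr_wpDl.
near=> x; split; first by near: x; exact: open_nbhs_nbhs.
have H : forall i, (grad h x - grad h a) ord0 i ^+ 2 <= e'.
  near: x; apply: filter_forall => i.
  have := ch i a Ua => /(@cvgr_dist_le _ _ _ _ _ _ _) /(_ (Num.sqrt e')).
  rewrite sqrtr_gt0 => /(_ e'0); apply: filterS => x.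
  rewrite !mxE distrC => hx; rewrite -(sqr_sqrtr (ltW e'0)).
  rewrite -(real_normK (num_real _)) lerXn2r ?nnegrE ?sqrtr_ge0//.
apply: (@le_lt_trans _ _ (\sum_(i < d) e')).
  by apply: ler_sum => i _; rewrite -expr2.
rewrite sumr_const card_ord -mulr_natr /e' mulrAC ltr_pdivrMr ?ltr_wpDl//.
by rewrite ltr_pM2l// ltrDl.
Unshelve. all: by end_near. Qed.

(** Strict differentiability: the error is relative to x - p with both points free,
    since the gradient at the intermediate point of the mean value theorem is
    close to the one at a. Expanding between two moving points, instead of from a,
    is what the comparison of x with its penalised minimiser requires. *)
Lemma C1_strict_diff U h a (e : R) : open U -> U a -> Ck_on 1 U h -> 0 < e ->
  exists2 rho, 0 < rho & forall x p, `|x - a| < rho -> `|p - a| < rho ->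
    (h x - h p - dot (x - p) (grad h a)) ^+ 2 <= e * dot (x - p) (x - p).
Proof.
move=> oU Ua hU e0.
have [rho rho0 hr] := near_radius (C1_partial_near oU Ua hU e0).
exists rho => // x p xa pa.
have xE : x = p + (x - p) by rewrite addrC subrK.
have inb (s : R) : 0 <= s <= 1 -> `|p + s *: (x - p) - a| < rho.
  by apply: line_in_ball; rewrite // -xE.
have [|s s01] := @mvt_line h p (x - p).
  by move=> s /inb /hr[+ _]; case: hU => dh _; exact: dh.
rewrite -xE => ->; rewrite -dotNr -dotDr.
have [_ /ltW hs] := hr _ (inb s s01).
apply: (le_trans (cauchy_schwarz _ _)); rewrite mulrC.
by rewrite ler_wpM2r// dot_ge0.
Qed.

Lemma C2_grad_strict_diff U f a (e : R) : open U -> U a -> Ck_on 2 U f -> 0 < e ->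
  exists2 rho, 0 < rho & forall x p, `|x - a| < rho -> `|p - a| < rho ->
    exists2 r, grad f x = grad f p + (x - p) *m hess f a + r &
      dot r r <= e * dot (x - p) (x - p).
Proof.
move=> oU Ua [_ fU] e0.
pose e' := e / (d%:R + 1).
have e'0 : 0 < e' by rewrite divr_gt0// ltr_wpDl.
have /choice[rho hr] i : exists rho, 0 < rho /\ forall x p,
    `|x - a| < rho -> `|p - a| < rho ->
    (partial i f x - partial i f p - dot (x - p) (grad (partial i f) a)) ^+ 2
      <= e' * dot (x - p) (x - p).
  by have [rho ? ?] := C1_strict_diff oU Ua (fU i) e'0; exists rho.
exists (\big[Num.min/1]_i rho i) => [|x p xa pa].
  by apply/bigmin_gtP; split => // i _; have [] := hr i.
exists (grad f x - grad f p - (x - p) *m hess f a).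
  by apply/rowP => i; rewrite !mxE; ring.
apply: (@le_trans _ _ (\sum_(i < d) e' * dot (x - p) (x - p))).
  apply: ler_sum => i _; rewrite -expr2 !mxE.
  have -> : \sum_j (x - p) ord0 j * hess f a j i =
            dot (x - p) (grad (partial i f) a).
    by apply: eq_bigr => j _; rewrite !mxE.
  apply: (hr i).2.
    by apply: (lt_le_trans xa); exact: bigmin_le_cond.
  by apply: (lt_le_trans pa); exact: bigmin_le_cond.
rewrite sumr_const card_ord -mulr_natr mulrAC ler_wpM2r ?dot_ge0//.
by rewrite /e' -mulrA -[leRHS]mulr1 ler_pM2l// mulrC ler_pdivrMr ?ltr_wpDl// mul1r lerDl.
Qed.

Lemma hess_near U f a (e : R) : open U -> U a -> Ck_on 2 U f -> 0 < e ->
  \forall x \near a, fro2 (hess f x - hess f a) <= e.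
Proof.
move=> oU Ua [_ fU] e0.
pose e' := e / (d%:R + 1).
have e'0 : 0 < e' by rewrite divr_gt0// ltr_wpDl.
near=> x.
rewrite /fro2 exchange_big /=.
apply: (@le_trans _ _ (\sum_(i < d) e')).
  apply: ler_sum => i _.
  have -> : \sum_j (hess f x - hess f a) j i ^+ 2 =
      dot (grad (partial i f) x - grad (partial i f) a)
          (grad (partial i f) x - grad (partial i f) a).
    by apply: eq_bigr => j _; rewrite !mxE expr2.
  move: i; near: x; apply: filter_forall => i.
  by apply: filterS (C1_partial_near oU Ua (fU i) e'0) => x [_ /ltW].
rewrite sumr_const card_ord -mulr_natr /e' mulrAC ler_pdivrMr ?ltr_wpDl//.
by rewrite ler_pM2l// lerDl.
Unshelve. all: by end_near. Qed.

End Calculus.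

(** * Derivatives along curves *)

Section CurveDerivatives.
Context {R : realType} {d : nat}.
Implicit Types (f : 'rV[R]_d -> R) (U : set 'rV[R]_d).
Implicit Types (y z : R -> 'rV[R]_d) (t : R).

Lemma is_derive_coord y t (dy : 'rV[R]_d) i : is_derive t 1 y dy ->
  is_derive t 1 (fun s => y s ord0 i) (dy ord0 i).
Proof.
move=> [yt <-]; apply: DeriveDef; first exact: ((derivable_mxP _ _ _).1 yt).
by rewrite derive_mx// mxE.
Qed.

Lemma is_derive_row y t (dy : 'rV[R]_d) :
  (forall i, is_derive t 1 (fun s => y s ord0 i) (dy ord0 i)) -> is_derive t 1 y dy.
Proof.
move=> H; have yt : derivable y t 1.
  by apply/derivable_mxP => i j; rewrite ord1; case: (H j).
apply: DeriveDef => //; rewrite derive_mx//; apply/rowP => j; rewrite mxE.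
by case: (H j).
Qed.

Lemma is_derive_dot y z t (dy dz : 'rV[R]_d) :
  is_derive t 1 y dy -> is_derive t 1 z dz ->
  is_derive t 1 (fun s => dot (y s) (z s)) (dot dy (z t) + dot (y t) dz).
Proof.
move=> hy hz.
have h i := is_deriveM (is_derive_coord i hy) (is_derive_coord i hz).
have := is_derive_sum h.
have -> : \sum_(i < d) (y t ord0 i *: dz ord0 i + z t ord0 i *: dy ord0 i) =
    dot dy (z t) + dot (y t) dz.
  rewrite /dot -big_split; apply: eq_bigr => i _ /=.
  by rewrite /GRing.scale/= addrC [z t ord0 i * _]mulrC.
have -> // : \sum_(i < d) ((fun s => y s ord0 i) * (fun s => z s ord0 i)) =
    (fun s => dot (y s) (z s)).
by apply/funext => s; rewrite fct_sumE.
Qed.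

Lemma is_derive_mulmx y t (dy : 'rV[R]_d) (A : 'M[R]_d) :
  is_derive t 1 y dy -> is_derive t 1 (fun s => y s *m A) (dy *m A).
Proof.
move=> hy; apply: is_derive_row => i.
pose c : 'rV[R]_d := \row_j A j i.
have E u : (u *m A) ord0 i = dot u c by rewrite mxE; apply: eq_bigr => j _; rewrite mxE.
have := is_derive_dot hy (is_derive_cst c t (1 : R)).
rewrite E -[dot (y t) 0]dotC dot0l addr0.
have -> // : (fun s => (y s *m A) ord0 i) = (fun s => dot (y s) c).
by apply/funext => s; rewrite E.
Qed.

Lemma is_derive_grad U f y t (dy : 'rV[R]_d) : Ck_on 2 U f -> U (y t) ->
  is_derive t 1 y dy ->
  is_derive t 1 (fun s => grad f (y s)) (dy *m hess f (y t)).
Proof.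
move=> [_ fU] Uy hy; apply: is_derive_row => i.
have dh : differentiable (partial i f) (y t) by case: (fU i) => + _; exact.
have yd : differentiable y t by apply/derivable1_diffP; case: hy.
have dc := differentiable_comp yd dh.
have hE : (fun s => grad f (y s) ord0 i) = partial i f \o y.
  by apply/funext => s; rewrite mxE.
rewrite hE; apply: DeriveDef; first exact: diff_derivable.
rewrite (deriveE _ dc) (diff_comp yd dh) /= -(deriveE _ yd).
have [_ ->] := hy.
rewrite (diff_grad _ dh) mxE.
by apply: eq_bigr => j _; rewrite !mxE.
Qed.

End CurveDerivatives.

(** * Second-order expansions *)

Section SecondOrder.
Context {R : realType} {d : nat}.
Implicit Types (f : 'rV[R]_d -> R) (a u v x : 'rV[R]_d) (U : set 'rV[R]_d).

(** The left-hand side is symmetric in u and v except for the Hessian term; this is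
    what makes [hess_sym] follow. *)
Lemma second_difference U f a (e : R) : open U -> U a -> Ck_on 2 U f -> 0 < e ->
  exists2 rho, 0 < rho & forall u v, `|u| < rho -> `|v| < rho ->
    (f (a + u + v) - f (a + u) - (f (a + v) - f a) - dot (u *m hess f a) v) ^+ 2
      <= e * (dot u u * dot v v).
Proof.
move=> oU Ua fU e0.
have [rho rho0 hr] := C2_grad_strict_diff oU Ua fU e0.
have [rho1 rho10 hr1] := near_radius (open_nbhs_nbhs (conj oU Ua)).
pose m := Num.min rho rho1.
have m0 : 0 < m by rewrite lt_min rho0 rho10.
exists (m / 2) => [|u v uE vE]; first by rewrite divr_gt0.
(* both segments of the mixed difference stay in the ball *)
have inb (s : R) : 0 <= s <= 1 ->
    `|a + s *: v - a| < m /\ `|a + u + s *: v - a| < m.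
  move=> /andP[s0 s1].
  have sv : `|s *: v| < m / 2.
    by rewrite normrZ ger0_norm// (le_lt_trans _ vE)// ler_piMl.
  have -> : a + s *: v - a = s *: v by rewrite addrC addKr.
  have -> : a + u + s *: v - a = u + s *: v.
    by apply/rowP => i; rewrite !mxE; ring.
  split; first by apply: lt_le_trans sv _; lra.
  by rewrite (splitr m) (le_lt_trans (ler_normD _ _))// ltrD.
have df x : `|x - a| < m -> differentiable f x.
  by rewrite lt_min => /andP[_ /hr1]; case: fU => + _; exact.
pose phi := (fun s : R => f (a + u + s *: v)) - (fun s : R => f (a + s *: v)).
pose dphi (s : R) := dot v (grad f (a + u + s *: v)) - dot v (grad f (a + s *: v)).
have dp (s : R) : 0 <= s <= 1 -> is_derive s 1 phi (dphi s).
  move=> /inb[h1 h2].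
  by apply: is_deriveB; apply: is_derive_line; apply: df.
have [s s01] := mvt01 dp.
rewrite /phi !fctE !scale1r !scale0r !addr0 => e1.
have [h1 h2] := inb s s01.
have [|| r rE hr'] := hr (a + u + s *: v) (a + s *: v).
- by move: h2; rewrite lt_min => /andP[].
- by move: h1; rewrite lt_min => /andP[].
have uE' : a + u + s *: v - (a + s *: v) = u.
  by apply/rowP => i; rewrite !mxE; ring.
rewrite uE' in rE hr'.
have -> : f (a + u + v) - f (a + u) - (f (a + v) - f a) - dot (u *m hess f a) v
   = dot v r.
  have -> : f (a + u + v) - f (a + u) - (f (a + v) - f a) =
    f (a + u + v) - f (a + v) - (f (a + u) - f a) by ring.
  by rewrite e1 /dphi rE !dotE (dotC _ v); ring.
apply: le_trans (cauchy_schwarz _ _) _.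
by rewrite mulrC mulrA ler_wpM2r// dot_ge0.
Qed.

(** Schwarz's theorem: after scaling, the same second difference approximates both
    <u H, v> and <v H, u>. *)
Lemma hess_sym U f a : open U -> U a -> Ck_on 2 U f -> (hess f a)^T = hess f a.
Proof.
move=> oU Ua fU.
suff H u v : dot (u *m hess f a) v = dot (v *m hess f a) u.
  apply/matrixP => i j; rewrite mxE.
  have E k l : hess f a k l = dot (delta_mx ord0 k *m hess f a) (delta_mx ord0 l).
    rewrite -rowE /dot (bigD1 l) //= big1 ?addr0 => [|m /negbTE ml].
      by rewrite !mxE !eqxx mulr1.
    by rewrite !mxE ml andbF mulr0.
  by rewrite !E H.
apply/eqP; rewrite -subr_eq0 -sqrf_eq0 eq_le sqr_ge0 andbT.
apply: (@le0_of_small_multiples _ _ (4 * (dot u u * dot v v))) => s /andP[s0 _].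
have [rho rho0 hr] := second_difference oU Ua fU s0.
have [ku ku0 hu] := exists_small_scale u rho0.
have [kv kv0 hv] := exists_small_scale v rho0.
have := hr _ _ hu hv; have := hr _ _ hv hu.
have -> : f (a + kv *: v + ku *: u) = f (a + ku *: u + kv *: v).
  by rewrite addrAC.
rewrite -!scalemxAl !dotZl !dotZr.
set F := f (a + _ + _); set F1 := f (a + _); set F2 := f (a + _).
set p := dot (v *m _) u; set q := dot (u *m _) v.
set D := F - F1 - (F2 - f a) => h1 h2.
have h3 : (ku * kv * (q - p)) ^+ 2 <=
    (ku * kv) ^+ 2 * (s * (4 * (dot u u * dot v v))).
  have -> : ku * kv * (q - p) =
    (D - kv * (ku * p)) - (F - F2 - (F1 - f a) - ku * (kv * q)).
    by rewrite /D; ring.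
  apply: (@le_trans _ _ (2 * ((D - kv * (ku * p)) ^+ 2 +
     (F - F2 - (F1 - f a) - ku * (kv * q)) ^+ 2))).
    by rewrite -subr_ge0; set x := D - _; set y := _ - ku * _;
      have := sqr_ge0 (x + y); lra.
  by apply: le_trans (ler_wpM2l _ (lerD h1 h2)) _; rewrite // -subr_ge0; lra.
by move: h3; rewrite exprMn ler_pM2l// exprn_gt0// mulr_gt0.
Qed.

Lemma taylor2 U f a (e : R) : open U -> U a -> Ck_on 2 U f -> grad f a = 0 ->
  0 < e -> exists2 rho, 0 < rho & forall u, `|u| < rho ->
    `|f (a + u) - f a - 2^-1 * dot (u *m hess f a) u| <= e * dot u u.
Proof.
move=> oU Ua fU ga e0.
have e20 : 0 < e ^+ 2 by rewrite exprn_gt0.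
have [rho rho0 hr] := C2_grad_strict_diff oU Ua fU e20.
have [rho1 rho10 hr1] := near_radius (open_nbhs_nbhs (conj oU Ua)).
pose m := Num.min rho rho1.
have m0 : 0 < m by rewrite lt_min rho0 rho10.
exists m => // u um.
have inb (s : R) : 0 <= s <= 1 -> `|a + s *: u - a| < m.
  move=> s01; apply: line_in_ball => //; first by rewrite subrr normr0.
  by rewrite [a + u]addrC addrK.
have df x : `|x - a| < m -> differentiable f x.
  by rewrite lt_min => /andP[_ /hr1]; case: fU => + _; exact.
pose q := dot (u *m hess f a) u.
pose phi := (fun s : R => f (a + s *: u)) - (2^-1 * q) \*: (fun s : R => s ^+ 2).
pose dphi (s : R) := dot u (grad f (a + s *: u)) - (2^-1 * q) *: (2 * s).
have dp (s : R) : 0 <= s <= 1 -> is_derive s 1 phi (dphi s).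
  move=> /inb h1; apply: is_deriveB.
    by apply: is_derive_line; apply: df.
  apply: is_deriveZ; apply: is_derive_eq.
  by rewrite [s%:A]mulr1 mulr_natl.
have [s s01] := mvt01 dp; have /andP[s0 s1] := s01.
rewrite /phi !fctE !scale1r !scale0r !addr0 => e1.
have := inb s s01; rewrite lt_min => /andP[h1 _].
have [|r rE hr'] := hr _ a h1; first by rewrite subrr normr0.
have uE' : a + s *: u - a = s *: u by rewrite addrC addKr.
rewrite uE' ga add0r -scalemxAl in rE; rewrite uE' !dotE in hr'.
have -> : f (a + u) - f a - 2^-1 * dot (u *m hess f a) u = dot u r.
  have E : f (a + u) - f a - 2^-1 * q = dphi s.
    by rewrite -e1 /= expr1n expr0n scaler0 subr0 [_ *: 1]mulr1 addrAC.
  rewrite E /dphi rE !dotE (dotC u (u *m _)) -/q /GRing.scale/=.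
  by field.
apply: sqr_le_norm; first by rewrite mulr_ge0 ?dot_ge0 ?ltW.
apply: le_trans (cauchy_schwarz _ _) _.
rewrite exprMn [X in _ <= _ * X]expr2 mulrA [X in X <= _]mulrC ler_wpM2r ?dot_ge0//.
apply: le_trans hr' _; rewrite ler_wpM2l ?sqr_ge0// mulrA ler_piMl ?dot_ge0//.
by rewrite mulr_ile1.
Qed.

Lemma quadratic_upper_bound U f a : open U -> U a -> Ck_on 2 U f ->
  grad f a = 0 ->
  \forall x \near a, f x - f a <= (fro2 (hess f a) + 2) * dot (x - a) (x - a).
Proof.
move=> oU Ua fU ga.
have [rho rho0 hr] := taylor2 oU Ua fU ga ltr01.
apply/nbhs_normP; exists rho => // x; rewrite /ball_/= distrC => /hr.
rewrite [a + _]addrC subrK ler_norml => /andP[_].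
have := dot_mulmx_norm_le (hess f a) (x - a) (x - a).
have := fro2_ge0 (hess f a); have := dot_ge0 (x - a).
set q := dot (_ *m _) _; set w := dot _ _; set K := fro2 _ => w0 K0 h1 h2.
have := mulr_ge0 K0 w0; lra.
Qed.

End SecondOrder.

(** * Minimisers of a quadratic penalisation *)

Section Penalised.
Context {R : realType} {d : nat}.
Implicit Types (f : 'rV[R]_d -> R) (a p u x : 'rV[R]_d) (U : set 'rV[R]_d).

Lemma dot_sub_continuous x : continuous (fun y : 'rV[R]_d => dot (y - x) (y - x)).
Proof.
move=> y; rewrite /dot; apply: cvg_big => [||i _].
- exact: add_continuous.
- exact: nbhs_filter.
have h : (fun z : 'rV[R]_d => (z - x) ord0 i) @ y --> (y - x) ord0 i.
  have hB : {for y, continuous (fun z : 'rV[R]_d => z - x)}.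
    apply: (@continuousB _ _ _ id (cst x)); first exact: cvg_id.
    exact: cst_continuous.
  exact: (continuous_comp hB (@coord_continuous _ _ _ ord0 i (y - x))).
exact: (cvgM h h).
Qed.

(** The first-order condition at an interior minimiser of f + c |. - x|^2, tested
    along the line through p in the direction of its own defect u. *)
Lemma penalised_critical f p x (c rho : R) : 0 < rho ->
  (forall y, `|y - p| < rho -> differentiable f y) ->
  (forall y, `|y - p| < rho ->
    f p + c * dot (p - x) (p - x) <= f y + c * dot (y - x) (y - x)) ->
  grad f p = (2 * c) *: (x - p).
Proof.
move=> rho0 df pmin; pose u := grad f p - (2 * c) *: (x - p).
suff : u = 0 by move/eqP; rewrite subr_eq0 => /eqP.
apply: dot_eq0.
have [k k0 hk] := exists_small_scale u rho0.
have inb (s : R) : s \in `](-k), k[%R -> `|p + s *: u - p| < rho.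
  rewrite in_itv /= => /andP[s1 s2]; rewrite addrC addKr.
  apply: le_lt_trans hk; rewrite !normrZ ler_wpM2r//.
  by rewrite (gtr0_norm k0) ler_norml !ltW.
pose A := dot (p - x) (p - x); pose B := dot u (p - x); pose D := dot u u.
pose quad (s : R) := c * A + 2 * c * B * s + c * D * s ^+ 2.
have quadE s : quad s = c * dot (p + s *: u - x) (p + s *: u - x).
  have -> : p + s *: u - x = (p - x) + s *: u by rewrite addrAC.
  rewrite /quad /A /B /D; clearbody u.
  by move: (p - x) => y; rewrite !dotE (dotC y u); ring.
pose phi := (fun s : R => f (p + s *: u)) + quad.
have dphi (s : R) : s \in `](-k), k[%R -> is_derive s 1 phi
    (dot u (grad f (p + s *: u)) + (2 * c * B + 2 * (c * D) * s)).
  move=> sk; apply: is_deriveD; last exact: is_derive_quadratic.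
  by apply: is_derive_line; apply: df; exact: inb.
have k00 : 0 \in `](-k), k[%R by rewrite in_itv /= oppr_lt0 k0.
have kk : - k <= k by lra.
have fmin t : t \in `](-k), k[%R -> phi 0 <= phi t.
  by move=> /inb /pmin; rewrite /phi !fctE !quadE scale0r addr0.
have [|_ d0] := @derive1_at_min R phi (-k) k 0 kk _ k00 fmin.
  by move=> t /dphi[].
have [_] := dphi 0 k00; rewrite d0 scale0r addr0 mulr0 addr0 /B => e0.
transitivity (dot u (grad f p - (2 * c) *: (x - p))); first by [].
by clearbody u; move: e0; rewrite !dotE; lra.
Qed.

(** The minimiser over a closed ball around a is interior, because the penalty
    c |p - x|^2 is at most f x - f a, which vanishes as x tends to a. *)
Lemma penalised_min_exists U f a (c rho : R) : open U -> U a ->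
  (forall x, U x -> differentiable f x) -> (\forall y \near a, f a <= f y) ->
  0 < c -> 0 < rho ->
  \forall x \near a, exists p,
    [/\ `|p - a| < rho, grad f p = (2 * c) *: (x - p) &
        c * dot (x - p) (x - p) <= f x - f a].
Proof.
move=> oU Ua df fmin c0 rho0.
have [r0 r00 hr0] := near_radius (open_nbhs_nbhs (conj oU Ua)).
have [r1 r10 hr1] := near_radius fmin.
pose m := Num.min rho (Num.min r0 r1).
have m0 : 0 < m by rewrite !lt_min rho0 r00 r10.
have inb y : `|y - a| < m -> [/\ `|y - a| < rho, U y & f a <= f y].
  by rewrite !lt_min => /and3P[? /hr0 ? /hr1 ?].
have q0 : 0 < c * (m / 8) ^+ 2 by rewrite mulr_gt0// exprn_gt0// divr_gt0.
have m80 : 0 < m / 8 by rewrite divr_gt0.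
have cf := differentiable_continuous (df a Ua).
near=> x.
have xa : `|x - a| < m / 8.
  rewrite distrC; near: x; exact: (@cvgr_dist_lt _ _ _ _ _ id).
have fx : f x - f a < c * (m / 8) ^+ 2.
  have : `|f a - f x| < c * (m / 8) ^+ 2 by near: x; exact: cvgr_dist_lt.
  by rewrite distrC => /(le_lt_trans (ler_norm _)).
(* the minimiser p found below lies within m / 4 of a, so that a neighbourhood of it
   is still in K, where it can be compared with p *)
pose K := [set y : 'rV[R]_d | `|y - a| <= m / 2].
have KE y : K y -> `|y - a| < m by rewrite /K/= => /le_lt_trans; apply; lra.
have cK : compact K.
  have KE' : K = closed_ball_ Num.norm a (m / 2).
    by apply/seteqP; split => y; rewrite /K/closed_ball_/= distrC.
  apply: bounded_closed_compact; last by rewrite KE'; exact: closed_closed_ball_.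
  exists (`|a| + m / 2); split; first exact: num_real.
  move=> M aM y yK; apply: le_trans (ltW aM).
  rewrite -[y in `|y|](subrK a) addrC.
  by apply: le_trans (ler_normD _ _) _; rewrite lerD2l.
pose psi y := f y + c * dot (y - x) (y - x).
have cpsi : {within K, continuous psi}.
  apply/continuous_in_subspaceT => y; rewrite inE => /KE /inb[_ /df dfy _].
  have hq : {for y, continuous (fun z : 'rV[R]_d => c * dot (z - x) (z - x))}.
    exact: (continuousM (@cst_continuous _ _ c y) (@dot_sub_continuous x y)).
  exact: (continuousD (differentiable_continuous dfy) hq).
have [p pK pmin] : exists2 p, p \in K & forall t, t \in K -> psi p <= psi t.
  by apply: EVT_min_rV => //; exists a; rewrite /K/= subrr normr0 divr_ge0// ltW.
have xK : K x by rewrite /K/= (le_trans (ltW xa))//; lra.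
rewrite inE in pK; have [_ Up fp] := inb p (KE p pK).
have := pmin x; rewrite inE => /(_ xK).
rewrite /psi subrr dot0l mulr0 addr0 => h1.
have h2 : dot (x - p) (x - p) = dot (p - x) (p - x).
  by rewrite -opprB dotNl dotNr opprK.
have px : `|p - x| < m / 8.
  rewrite -(ltr_pXn2r (n := 2)) ?nnegrE ?normr_ge0 ?(ltW m80)//.
  apply: le_lt_trans (norm_le_dot _) _.
  rewrite -(ltr_pM2l c0); apply: le_lt_trans fx; lra.
have pa : `|p - a| < m / 4.
  have -> : p - a = (p - x) + (x - a) by rewrite addrA subrK.
  by apply: le_lt_trans (ler_normD _ _) _; lra.
have pinb y : `|y - p| < m / 8 -> K y.
  move=> yp; rewrite /K/=.
  have -> : y - a = (y - p) + (p - a) by rewrite addrA subrK.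
  by apply: le_trans (ler_normD _ _) _; lra.
exists p; split.
- by have [] := inb p (KE p pK).
- apply: (penalised_critical (rho := m / 8)); first by rewrite divr_gt0.
    by move=> y /pinb /KE /inb[_ /df].
  by move=> y /pinb yK; apply: pmin; rewrite inE.
- by rewrite h2; lra.
Unshelve. all: by end_near.
Qed.

End Penalised.

(** * Spectral gap inherited by perturbed range vectors *)

Section SpectralGap.
Context {R : realType} {d : nat}.

(** With w = u H, positivity of H at mu u - w gives
    mu^2 <u H, u> - 2 mu |w|^2 + <w H, w> >= 0, and the first term is at most
    mu |w|^2. This derives H^3 >= mu H^2 from H^2 >= mu H without diagonalising. *)
Lemma pl_range_gap (H : 'M[R]_d) (mu : R) u : H^T = H -> 0 < mu ->
  (forall w, 0 <= dot (w *m H) w) ->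
  (forall w, mu * dot (w *m H) w <= dot (w *m H) (w *m H)) ->
  mu * dot (u *m H) (u *m H) <= dot (u *m H *m H) (u *m H).
Proof.
move=> Hsym mu0 psd pl; set w := u *m H.
have := psd (mu *: u - w); have := pl u; rewrite -/w => h1.
rewrite mulmxBl -scalemxAl -/w !dotE.
have -> : dot (w *m H) u = dot w w by rewrite dot_mulmxA Hsym.
move=> h2; have {}h1 := ler_wpM2l (ltW mu0) h1; lra.
Qed.

(** Every term containing r is controlled by t |g|^2, through Young's inequality with
    weight t; here |r| <= t |g|. *)
Lemma gap_perturbation (H : 'M[R]_d) (mu t : R) (g h r : 'rV[R]_d) :
  H^T = H -> (forall w, 0 <= dot (w *m H) w) -> 0 < mu -> 0 < t <= 1 ->
  mu * dot h h <= dot (h *m H) h -> g = h + r ->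
  dot r r <= t ^+ 2 * dot g g ->
  (mu - t * (2 * fro2 H + 2 * mu + 2)) * dot g g <= dot (g *m H) g.
Proof.
move=> Hs psd mu0 /andP[t0 t1] gap_h gE rr.
have hE : h = g - r by rewrite gE addrK.
have rr1 : t^-1 * dot r r <= t * dot g g.
  by rewrite -(ler_pM2l t0) mulrA mulfV ?gt_eqF// mul1r mulrA -expr2.
have rr2 : dot r r <= t * dot g g.
  apply: le_trans rr _; rewrite ler_wpM2r ?dot_ge0// expr2.
  by rewrite ler_piMr// ltW.
have y1 := dot_young (g *m H) (- r) t0.
have y2 := dot_young g r t0.
have b1 := dot_mulmx_le g H.
have b2 := dot_mulmx_norm_le H r r.
have K0 := fro2_ge0 H.
have b3 := ler_wpM2l K0 rr2.
have b4 := ler_wpM2l (ltW mu0) y2.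
have b5 := ler_wpM2l (ltW mu0) rr1.
have b6 := ler_wpM2l (ltW t0) b1.
have tK : 0 <= t * (fro2 H * dot g g).
  by rewrite !mulr_ge0 ?dot_ge0// ltW.
have tG : 0 <= t * dot g g by rewrite mulr_ge0 ?dot_ge0// ltW.
have tmu : 0 <= mu * dot r r by rewrite mulr_ge0 ?dot_ge0// ltW.
move: gap_h; rewrite hE mulmxBl !dotE.
have -> : dot (r *m H) g = dot (g *m H) r by rewrite dot_mulmxA Hs dotC.
rewrite (dotC r g); move: y1; rewrite !dotE !opprK.
move: tG tmu tK b6 b5 b4 b3 K0 b2 b1 y2 rr2 rr1.
lra.
Qed.

End SpectralGap.

(** * The Lyapunov function *)

Section Lyapunov.
Context {R : realType} {d : nat}.
Implicit Types (g v e : 'rV[R]_d) (H : 'M[R]_d).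

(** With w = v H, this is e^(- 2 r t) times the energy of the rescaled oscillator
    e^(r t) g, namely |w + r g|^2 + <g (H - (alpha r - r^2)), g>, plus the term that
    sees the kernel component of v. *)
Definition energy H (alpha r kappa : R) g v : R :=
  dot (v *m H + r *: g) (v *m H + r *: g) + dot (g *m H) g
  - (alpha * r - r ^+ 2) * dot g g + kappa * dot v v.

(** The derivative of [energy] when g and v have velocities dg and dv. *)
Definition denergy H (alpha r kappa : R) g v dg dv : R :=
  2 * dot (dv *m H + r *: dg) (v *m H + r *: g) + 2 * dot (g *m H) dg
  - 2 * (alpha * r - r ^+ 2) * dot dg g + 2 * kappa * dot dv v.

Lemma is_derive_energy H (alpha r kappa : R) (g v : R -> 'rV[R]_d)
    (t : R) (dg dv : 'rV[R]_d) :
  H^T = H -> is_derive t 1 g dg -> is_derive t 1 v dv ->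
  is_derive t 1 (fun s => energy H alpha r kappa (g s) (v s))
    (denergy H alpha r kappa (g t) (v t) dg dv).
Proof.
move=> Hs hg hv.
have hw := is_deriveD (is_derive_mulmx H hv) (is_deriveZ r hg).
have h1 := is_derive_dot hw hw.
have h2 := is_derive_dot (is_derive_mulmx H hg) hg.
have h3 := is_deriveZ (alpha * r - r ^+ 2) (is_derive_dot hg hg).
have h4 := is_deriveZ kappa (is_derive_dot hv hv).
have := is_deriveD (is_deriveB (is_deriveD h1 h2) h3) h4.
set D := (X in is_derive _ _ _ X -> _).
have -> // : D = denergy H alpha r kappa (g t) (v t) dg dv.
rewrite /D /denergy /GRing.scale/= !fctE.
have -> : dot (dg *m H) (g t) = dot (g t *m H) dg by rewrite dot_mulmxA Hs dotC.
rewrite (dotC (g t) dg) (dotC (v t) dv).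
rewrite [dot (v t *m H + r *: g t) (dv *m H + r *: dg)]dotC.
ring.
Qed.

Lemma energy_ge H (alpha r c kappa : R) g v : 0 < c ->
  (alpha * r - r ^+ 2 + c) * dot g g <= dot (g *m H) g ->
  kappa * dot v v <= energy H alpha r kappa g v.
Proof.
move=> c0 gap; rewrite /energy lerDr.
have := dot_ge0 (v *m H + r *: g); have := mulr_ge0 (ltW c0) (dot_ge0 g); lra.
Qed.

(** For e = 0 and kappa = 0 the derivative is exactly
    - 2 r E - 2 (alpha - 2 r) |w + r g|^2. Lowering the rate from r to r' frees
    2 (r - r') E, which dominates |w + r g|^2 and |g|^2; half of the |g|^2 part pays
    for the cross term of kappa |v|^2, which needs kappa small, and the rest pays
    for e, which needs delta small with respect to kappa. *)
Lemma energy_decay H (alpha r r' c : R) :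
  H^T = H -> 0 < r' < r -> 2 * r <= alpha -> 0 < c ->
  exists2 kappa, 0 < kappa & exists2 delta, 0 < delta & forall g v e,
    (alpha * r - r ^+ 2 + c) * dot g g <= dot (g *m H) g ->
    dot e e <= delta * dot v v ->
    denergy H alpha r kappa g v (v *m H + e) (- (alpha *: v) - g) <=
      - (2 * r') * energy H alpha r kappa g v.
Proof.
move=> Hs /andP[r'0 r'r] ralpha c0.
pose rho := r - r'; have rho0 : 0 < rho by rewrite subr_gt0.
pose beta := alpha - r'; have beta0 : 0 < beta by rewrite /beta; lra.
(* Young's inequality on 2 kappa <v, g> with weight beta costs (kappa / beta) |g|^2,
   which the slack rho c |g|^2 just covers for this kappa *)
pose kappa := rho * c * beta.
have kappa0 : 0 < kappa by rewrite !mulr_gt0.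
pose b := r ^+ 2 - alpha * r.
pose K := 4 * (r ^+ 2 + b ^+ 2 + fro2 H) + 1.
have K0 : 0 < K.
  by rewrite /K; have := fro2_ge0 H; have := sqr_ge0 r; have := sqr_ge0 b; lra.
pose m := Num.min 1 c; have m0 : 0 < m by rewrite lt_min ltr01.
pose theta := rho * m / K; have theta0 : 0 < theta by rewrite divr_gt0// mulr_gt0.
exists kappa => //; exists (theta * (kappa * beta)) => [|g v e gap ee].
  by apply: mulr_gt0 => //; exact: mulr_gt0.
(* q is the vector that the derivative of the energy pairs with e *)
pose w := v *m H; pose s := w + r *: g.
pose q := r *: s + (b *: g + g *m H).
have gg := dot_ge0 g; have ss := dot_ge0 s; have vv := dot_ge0 v.
have qq : dot q q <= K * (dot s s + dot g g).
  have q1 := dotDD_le (r *: s) (b *: g + g *m H).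
  have q2 := dotDD_le (b *: g) (g *m H).
  have q3 := dot_mulmx_le g H.
  rewrite -/q in q1; rewrite !(dotZl, dotZr) in q1 q2.
  have t0 := mulr_ge0 (sqr_ge0 r) ss.
  have t1 := mulr_ge0 (fro2_ge0 H) ss.
  have t2 := mulr_ge0 (sqr_ge0 r) gg.
  have t3 := mulr_ge0 (sqr_ge0 b) ss.
  rewrite /K; move: (dot q q) (dot (b *: g + g *m H) (b *: g + g *m H)) q1 q2 q3 t0 t1 t2 t3.
  move=> Q X; lra.
have thq : theta * dot q q <= rho * (dot s s + c * dot g g).
  have h : theta * dot q q <= theta * (K * (dot s s + dot g g)).
    by rewrite ler_wpM2l// ltW.
  apply: le_trans h _.
  have -> : theta * (K * (dot s s + dot g g)) = rho * (m * dot s s + m * dot g g).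
    by rewrite /theta; field; rewrite gt_eqF.
  rewrite ler_pM2l// lerD// ?ler_wpM2r//; last by rewrite ge_min lexx orbT.
  by rewrite ler_piMl// ge_min lexx.
have yq := dot_young q e theta0.
have the : theta^-1 * dot e e <= kappa * beta * dot v v.
  by rewrite ler_pdivrMl// mulrA.
have yg := dot_young (- v) g beta0.
rewrite dotNl !(dotNl, dotNr) opprK in yg.
have yg' : - (2 * kappa * dot v g) <= kappa * beta * dot v v + rho * c * dot g g.
  have := ler_wpM2l (ltW kappa0) yg.
  have -> : kappa * (beta * dot v v + beta^-1 * dot g g) =
    kappa * beta * dot v v + rho * c * dot g g.
    by rewrite /kappa; field; rewrite gt_eqF.
  lra.
(* the quadratic identity behind the decay; kappa |v|^2 is split off the energy
   because it decays at its own rate 2 alpha *)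
have main : denergy H alpha r kappa g v (w + e) (- (alpha *: v) - g) =
  - (2 * r) * (energy H alpha r kappa g v - kappa * dot v v)
  - 2 * (alpha - 2 * r) * dot s s + 2 * dot q e
  + 2 * kappa * (- alpha * dot v v - dot v g).
  rewrite /denergy /energy -/w -/s.
  have -> : (- (alpha *: v) - g) *m H = - (alpha *: w) - g *m H.
    by rewrite mulmxBl mulNmx -scalemxAl.
  rewrite /q /s /b; clearbody w; move: (g *m H) => h.
  rewrite !dotE ?(dotC g w) ?(dotC h w) ?(dotC h g) ?(dotC e g) ?(dotC e w).
  rewrite ?(dotC e h) ?(dotC g v).
  ring.
rewrite main.
have ass : 0 <= (alpha - 2 * r) * dot s s by rewrite mulr_ge0// subr_ge0.
have Vge : dot s s + c * dot g g <= energy H alpha r kappa g v - kappa * dot v v.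
  rewrite /energy -/w -/s; move: gap; lra.
move: (energy H alpha r kappa g v) Vge => E Vge.
have := ler_wpM2l (ltW rho0) Vge.
rewrite /beta in yg' the; rewrite /rho in thq yg' *.
have rss := mulr_ge0 (ltW rho0) ss; rewrite /rho in rss.
move: (dot q e) (dot q q) (dot e e) (dot v g) (theta^-1) yq the yg' ass Vge thq rss.
move=> x1 x2 x3 x4 x5; lra.
Qed.

End Lyapunov.

(** * Exponential decay from differential inequalities *)

Section ExponentialDecay.
Context {R : realType}.
Implicit Types (y dy : R -> R) (T k D l c : R).

Lemma is_derive_expRZ k (t : R) : 
  is_derive t 1 (fun s => expR (k * s)) (k * expR (k * t)).
Proof.
have h : is_derive t 1 (fun s : R => k * s) k.
  by have := is_deriveZ k (is_derive_id t (1 : R)); rewrite [_ *: 1]mulr1.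
have := is_derive1_comp (is_derive_expR (k * t)) h.
by rewrite mulrC.
Qed.

Lemma nonincreasing_halfline y dy T :
  (forall t, T <= t -> is_derive t 1 y (dy t)) -> (forall t, T <= t -> dy t <= 0) ->
  forall s t, T <= s -> s <= t -> y t <= y s.
Proof.
move=> hy dy0; apply: ler0_derive1_nincry => [t|t|].
- by rewrite in_itv/= andbT => /ltW /hy[].
- rewrite in_itv/= andbT => /ltW Tt; rewrite derive1E.
  by have [_ ->] := hy t Tt; exact: dy0.
- apply: derivable_within_continuous => t; rewrite in_itv/= andbT => /hy.
  by case.
Qed.

Lemma gronwall y dy T k : (forall t, T <= t -> is_derive t 1 y (dy t)) ->
  (forall t, T <= t -> dy t <= - k * y t) ->
  forall t, T <= t -> y t <= expR (k * T) * y T * expR (- k * t).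
Proof.
move=> hy dyk t Tt.
have hz s : T <= s -> is_derive s 1 (fun s => expR (k * s) * y s)
    (expR (k * s) * dy s + y s * (k * expR (k * s))).
  by move=> Ts; exact: (is_deriveM (is_derive_expRZ k s) (hy s Ts)).
have dz s : T <= s -> expR (k * s) * dy s + y s * (k * expR (k * s)) <= 0.
  move=> Ts; have -> : expR (k * s) * dy s + y s * (k * expR (k * s)) =
    expR (k * s) * (dy s - (- k * y s)) by ring.
  by rewrite mulr_ge0_le0 ?expR_ge0// subr_le0 dyk.
have := nonincreasing_halfline hz dz (lexx T) Tt.
by rewrite mulNr expRN ler_pdivlMr ?expR_gt0// mulrC.
Qed.

(** The function y + (D / k) e^(- k s) is nonincreasing, hence bounds its limit l:
    this replaces the integral of dy from t to infinity. *)
Lemma limit_gap_le y dy T k D l : 0 < k -> 0 <= D ->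
  (forall t, T <= t -> is_derive t 1 y (dy t)) ->
  (forall t, T <= t -> dy t <= D * expR (- k * t)) ->
  y t @[t --> +oo] --> l ->
  forall t, T <= t -> l - y t <= D / k * expR (- k * t).
Proof.
move=> k0 D0 hy dyD yl t Tt.
pose z (s : R) := y s + D / k * expR (- k * s).
have hz s : T <= s -> is_derive s 1 z (dy s + D / k * (- k * expR (- k * s))).
  by move=> Ts; exact: (is_deriveD (hy s Ts) (is_deriveZ (D / k) (is_derive_expRZ (- k) s))).
have dz s : T <= s -> dy s + D / k * (- k * expR (- k * s)) <= 0.
  move=> Ts; have -> : D / k * (- k * expR (- k * s)) = - (D * expR (- k * s)).
    by field; rewrite gt_eqF.
  by rewrite subr_le0 dyD.
rewrite lerBlDl; apply: (cvgr_to_le yl).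
near=> s.
apply: (@le_trans _ _ (z s)); first by rewrite lerDl mulr_ge0 ?expR_ge0// divr_ge0// ltW.
by apply: (nonincreasing_halfline hz dz) => //; near: s; apply: nbhs_pinfty_ge; exact: num_real.
Unshelve. all: by end_near. Qed.

Lemma limit_dist_le y dy T k D l : 0 < k -> 0 <= D ->
  (forall t, T <= t -> is_derive t 1 y (dy t)) ->
  (forall t, T <= t -> `|dy t| <= D * expR (- k * t)) ->
  y t @[t --> +oo] --> l ->
  forall t, T <= t -> `|y t - l| <= D / k * expR (- k * t).
Proof.
move=> k0 D0 hy dyD yl t Tt; rewrite distrC ler_norml; apply/andP; split.
  have hN s : T <= s -> is_derive s 1 (- y) (- dy s).
    by move=> Ts; exact: (is_deriveN (hy s Ts)).
  have bN s : T <= s -> - dy s <= D * expR (- k * s).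
    by move=> /dyD; apply: le_trans; rewrite -normrN ler_norm.
  have lN : (- y) s @[s --> +oo] --> - l by exact: cvgN.
  have := limit_gap_le k0 D0 hN bN lN Tt.
  by rewrite opprfctE; lra.
apply: (limit_gap_le k0 D0 hy _ yl Tt) => s /dyD; apply: le_trans.
exact: ler_norm.
Qed.

Lemma cvg_expRN c (C : R) : 0 < c -> C * expR (- c * t) @[t --> +oo] --> (0 : R).
Proof.
move=> c0; rewrite -[X in _ --> X](mulr0 C); apply: cvgM; first exact: cvg_cst.
apply/cvgrPdist_lt => e e0; near=> t.
rewrite sub0r normrN ger0_norm ?expR_ge0// -[e]lnK ?posrE// ltr_expR.
rewrite mulNr ltrNl -ltr_pdivrMl//.
by near: t; apply: nbhs_pinfty_gt; exact: num_real.
Unshelve. all: by end_near. Qed.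

End ExponentialDecay.

(** * The rate m(alpha) *)

Section Rate.
Context {R : realType}.
Implicit Types mu alpha r : R.

Lemma hb_rate_gt0 mu alpha : 0 < mu -> 0 < alpha -> 0 < hb_rate mu alpha.
Proof.
move=> mu0 a0; rewrite /hb_rate mulr_gt0 ?invr_gt0// subr_gt0.
rewrite -ltr_sqr ?nnegrE ?sqrtr_ge0 ?(ltW a0)// sqr_sqrtr ?le_max ?lexx//.
by rewrite gt_max exprn_gt0//= ltrBlDr ltrDl mulr_gt0.
Qed.

(** The number m(alpha) is the smaller root of r^2 - alpha r + mu, or alpha / 2 when
    the roots are not real. *)
Lemma lt_hb_rate mu alpha r : r < hb_rate mu alpha ->
  2 * r <= alpha /\ 0 < r ^+ 2 - alpha * r + mu.
Proof.
rewrite /hb_rate; set M := Num.max _ _; set s := Num.sqrt M => rm.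
have s0 : 0 <= s by exact: sqrtr_ge0.
have sM : s ^+ 2 = M by rewrite sqr_sqrtr// le_max lexx.
have M1 : alpha ^+ 2 - 4 * mu <= M by rewrite le_max lexx orbT.
split; first by lra.
have : s ^+ 2 < (alpha - 2 * r) ^+ 2.
  by rewrite ltr_sqr ?nnegrE//; lra.
rewrite sM; lra.
Qed.

Lemma hb_rate_opt mu : 0 < mu -> hb_rate mu (2 * Num.sqrt mu) = Num.sqrt mu.
Proof.
move=> mu0; rewrite /hb_rate exprMn sqr_sqrtr ?ltW//.
have -> : 2 ^+ 2 * mu - 4 * mu = 0 by ring.
by rewrite maxxx sqrtr0; field.
Qed.

Lemma hb_rate_le mu alpha : 0 < mu -> hb_rate mu alpha <= Num.sqrt mu.
Proof.
move=> mu0; rewrite /hb_rate; set q := Num.sqrt mu.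
have q0 : 0 <= q by exact: sqrtr_ge0.
have qE : q ^+ 2 = mu by rewrite sqr_sqrtr// ltW.
set M := Num.max _ _.
have : alpha - 2 * q <= Num.sqrt M.
  have [aq|qa] := leP alpha (2 * q).
    by apply: (@le_trans _ _ 0); [lra|exact: sqrtr_ge0].
  have aq0 : 0 <= alpha - 2 * q by lra.
  rewrite -(ger0_norm aq0) -sqrtr_sqr; apply: ler_wsqrtr.
  rewrite le_max; apply/orP; right; rewrite -qE.
  have := mulr_ge0 q0 aq0; lra.
lra.
Qed.

End Rate.

(** * Local geometry and dynamics at a Polyak-Lojasiewicz minimum *)

Section PLMinimum.
Context {R : realType} {d : nat} (U : set 'rV[R]_d) (f : 'rV[R]_d -> R).
Context (a : 'rV[R]_d) (mu : R).
Context (oU : open U) (Ua : U a) (fU : Ck_on 2 U f) (ga : grad f a = 0).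
Context (fmin : \forall y \near a, f a <= f y) (mu0 : 0 < mu).
Context (pl : forall y, U y -> 2 * mu * (f y - f a) <= enorm (grad f y) ^+ 2).
Implicit Type u : 'rV[R]_d.

Lemma hess_psd u : 0 <= dot (u *m hess f a) u.
Proof.
rewrite -oppr_le0.
apply: (@le0_of_small_multiples _ _ (2 * dot u u)) => s /andP[s0 _].
have [rho rho0 hr] := taylor2 oU Ua fU ga s0.
have [rho1 rho10 hr1] := near_radius fmin.
have m0 : 0 < Num.min rho rho1 by rewrite lt_min rho0 rho10.
have [k k0] := exists_small_scale u m0; rewrite lt_min => /andP[h1 h2].
have /hr1 fmin' : `|a + k *: u - a| < rho1 by rewrite addrC addKr.
have := hr _ h1; rewrite ler_norml => /andP[_].
rewrite -!scalemxAl !dotE => h3.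
rewrite -subr_ge0 -(pmulr_rge0 _ (mulr_gt0 k0 k0)).
move: h3 fmin'; set q := dot _ u; set w := dot u u.
set F := f (a + _); lra.
Qed.

(** H^2 >= mu H: the inequality at a + k u, divided by k^2, as k tends to 0. The slack
    s plays the role of all the o(1) terms. *)
Lemma pl_hess u :
  mu * dot (u *m hess f a) u <= dot (u *m hess f a) (u *m hess f a).
Proof.
rewrite -subr_le0; set w := u *m _.
apply: (@le0_of_small_multiples _ _ (dot w w + (2 + 2 * mu) * dot u u)).
move=> s /andP[s0 s1].
have s20 : 0 < s ^+ 2 by rewrite exprn_gt0.
have [rho rho0 hr] := taylor2 oU Ua fU ga s0.
have [rho1 rho10 hr1] := C2_grad_strict_diff oU Ua fU s20.
have [rho2 rho20 hr2] := near_radius (open_nbhs_nbhs (conj oU Ua)).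
have m0 : 0 < Num.min rho (Num.min rho1 rho2) by rewrite !lt_min rho0 rho10 rho20.
have [k k0] := exists_small_scale u m0; rewrite !lt_min => /and3P[h1 h2 h3].
have uE' : a + k *: u - a = k *: u by rewrite addrC addKr.
have [|| r] := hr1 (a + k *: u) a; rewrite ?uE' ?subrr ?normr0//.
rewrite ga add0r -scalemxAl -/w => rE; rewrite !dotE => rr.
have := @pl (a + k *: u); rewrite enorm_sqr rE => /(_ (hr2 _ _)).
rewrite uE' => /(_ h3); rewrite !dotE (dotC r w) => h4.
have := hr _ h1; rewrite ler_norml => /andP[h5 _].
rewrite -!scalemxAl -/w !dotE in h5.
have := @dot_young R d (s * k) w (r) (mulr_gt0 s0 k0) => h6.
have {}h6 : 2 * (k * dot w r) <= k * (s * k * dot w w) + s^-1 * dot r r.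
  have := ler_wpM2l (ltW k0) h6.
  suff -> : k * (s * k * dot w w + (s * k)^-1 * dot r r) =
    k * (s * k * dot w w) + s^-1 * dot r r by lra.
  by field; rewrite !gt_eqF.
have h7 : s^-1 * dot r r <= s * (k * (k * dot u u)).
  rewrite -[leRHS](mulKf (lt0r_neq0 s0)) ler_pM2l ?invr_gt0//.
  by move: rr; rewrite expr2 -mulrA.
have h8 : s ^+ 2 * (k * (k * dot u u)) <= s * (k * (k * dot u u)).
  rewrite ler_wpM2r ?mulr_ge0 ?dot_ge0 ?(ltW k0)//.
  by rewrite expr2 ler_piMl// ltW.
rewrite -subr_ge0 -(pmulr_rge0 _ (mulr_gt0 k0 k0)).
have {}h5 := ler_wpM2l (ltW mu0) h5.
move: h4 h5 h6 h7 h8 rr.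
set q := dot w u; set W := dot w w; set V := dot u u; set X := dot w r.
set Y := dot r r; set F := f (a + _).
lra.
Qed.

(** The Polyak-Lojasiewicz inequality at x bounds c |x - p|^2 <= f x - f a by
    |g|^2 / (2 mu), so the gradient g at x equals (x - p) H up to errors that are
    small relative to |g|, and [pl_range_gap] applies to (x - p) H. *)
Lemma grad_hess_gap (delta : R) : 0 < delta ->
  \forall x \near a, (mu - delta) * dot (grad f x) (grad f x) <=
    dot (grad f x *m hess f a) (grad f x).
Proof.
move=> delta0; set H := hess f a.
have Hs : H^T = H := hess_sym oU Ua fU.
pose C := 2 * fro2 H + 2 * mu + 2.
have C0 : 0 < C by rewrite /C; have := fro2_ge0 H; have := mu0; lra.
pose t := Num.min 1 (delta / C).
have t0 : 0 < t by rewrite lt_min ltr01 divr_gt0.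
have t1 : t <= 1 by rewrite ge_min lexx.
have tC : t * C <= delta by rewrite -ler_pdivlMr// ge_min lexx orbT.
(* c makes the gradient 2 c (x - p) at p at most (t / 2) |g|, and e then makes the
   linearisation error, relative to |x - p| <= |g| / sqrt (2 mu c), as small *)
pose c := mu * t ^+ 2 / 8.
have c0 : 0 < c by rewrite divr_gt0// mulr_gt0// exprn_gt0.
pose e := t ^+ 2 * mu * c / 2.
have e0 : 0 < e by rewrite divr_gt0// !mulr_gt0// exprn_gt0.
have [rho rho0 hr] := C2_grad_strict_diff oU Ua fU e0.
have df : forall x, U x -> differentiable f x by case: fU.
near=> x.
have Ux : U x by near: x; exact: (open_nbhs_nbhs (conj oU Ua)).
have [p [pa gp px]] : exists p, [/\ `|p - a| < rho,
    grad f p = (2 * c) *: (x - p) & c * dot (x - p) (x - p) <= f x - f a].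
  by near: x; exact: (penalised_min_exists oU Ua df fmin c0 rho0).
have xa : `|x - a| < rho.
  by rewrite distrC; near: x; exact: (@cvgr_dist_lt _ _ _ _ _ id).
have [r gx rr] := hr _ _ xa pa.
set g := grad f x in gx *.
have plx := pl Ux; rewrite enorm_sqr -/g in plx.
have := @gap_perturbation _ _ H mu t g ((x - p) *m H) (grad f p + r) Hs hess_psd mu0.
have gE : g = (x - p) *m H + (grad f p + r) by rewrite gx addrCA addrA.
move=> /(_ (introT andP (conj t0 t1)) (pl_range_gap _ Hs mu0 hess_psd pl_hess) gE) h.
apply: le_trans (h _); first by rewrite ler_wpM2r ?dot_ge0// lerD2l lerN2.
have w0 := dot_ge0 (x - p).
apply: le_trans (dotDD_le _ _) _; rewrite gp dotZl dotZr.
move: (dot (x - p) (x - p)) w0 px rr => w w0 px rr.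
have b1 : 2 * mu * (c * w) <= dot g g.
  by apply: le_trans plx; rewrite ler_wpM2l// mulr_ge0// ltW.
have b2 : t ^+ 2 * (2 * mu * (c * w)) <= t ^+ 2 * dot g g.
  by rewrite ler_wpM2l// sqr_ge0.
have b3 : 2 * c * (2 * c * w) = t ^+ 2 * (2 * mu * (c * w)) / 4.
  by rewrite /c; field.
have b4 : e * w = t ^+ 2 * (2 * mu * (c * w)) / 4 by rewrite /e; field.
rewrite b3; rewrite b4 in rr; lra.
Unshelve. all: by end_near. Qed.

Lemma velocity_decay (alpha k : R) (x v : R -> 'rV[R]_d) :
  0 < k < hb_rate mu alpha ->
  (forall t : R, 0 < t -> is_derive t 1 x (v t)) ->
  (forall t : R, 0 < t -> is_derive t 1 v (- (alpha *: v t) - grad f (x t))) ->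
  x t @[t --> +oo] --> a ->
  exists2 D, 0 <= D & exists2 T, 0 < T &
    forall t, T <= t -> dot (v t) (v t) <= (D * expR (- k * t)) ^+ 2.
Proof.
move=> /andP[k0 km] hx hv xa.
pose r := (k + hb_rate mu alpha) / 2.
have kr : 0 < k < r by rewrite k0 /r; lra.
have rm : r < hb_rate mu alpha by rewrite /r; lra.
have [ralpha gap0] := lt_hb_rate rm.
pose c := (r ^+ 2 - alpha * r + mu) / 2.
have c0 : 0 < c by rewrite divr_gt0.
set H := hess f a.
have Hs : H^T = H := hess_sym oU Ua fU.
have [kappa kappa0 [delta delta0 decay]] := energy_decay Hs kr ralpha c0.
(* mu is split as alpha r - r^2 + 2 c, one c being lost to [grad_hess_gap] *)
have near_a : \forall y \near a, [/\ U y,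
    (alpha * r - r ^+ 2 + c) * dot (grad f y) (grad f y) <=
      dot (grad f y *m H) (grad f y) & fro2 (hess f y - H) <= delta].
  have cE : alpha * r - r ^+ 2 + c = mu - c by rewrite /c; field.
  rewrite cE; near=> y; split; near: y.
  - exact: (open_nbhs_nbhs (conj oU Ua)).
  - exact: (grad_hess_gap c0).
  - exact: (hess_near oU Ua fU delta0).
have [T T0 near_T] : exists2 T, 0 < T & forall t, T <= t -> [/\ U (x t),
    (alpha * r - r ^+ 2 + c) * dot (grad f (x t)) (grad f (x t)) <=
      dot (grad f (x t) *m H) (grad f (x t)) & fro2 (hess f (x t) - H) <= delta].
  have [M [_ hM]] := xa _ near_a.
  exists (`|M| + 1) => [|t Tt]; first by rewrite ltr_wpDl.
  by apply: hM; have := ler_norm M; lra.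
pose W t := energy H alpha r kappa (grad f (x t)) (v t).
pose dW t := denergy H alpha r kappa (grad f (x t)) (v t)
   (v t *m hess f (x t)) (- (alpha *: v t) - grad f (x t)).
have hW t : T <= t -> is_derive t 1 W (dW t).
  move=> Tt; have t0 : 0 < t by exact: lt_le_trans Tt.
  have [Ux _ _] := near_T t Tt.
  exact: (is_derive_energy _ _ _ Hs (is_derive_grad fU Ux (hx t t0)) (hv t t0)).
have dWk t : T <= t -> dW t <= - (2 * k) * W t.
  move=> Tt; have [_ gap hess_le] := near_T t Tt.
  have -> : dW t = denergy H alpha r kappa (grad f (x t)) (v t)
     (v t *m H + v t *m (hess f (x t) - H)) (- (alpha *: v t) - grad f (x t)).
    by rewrite /dW -mulmxDr [H + _]addrC subrK.
  apply: decay => //; apply: le_trans (dot_mulmx_le _ _) _.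
  by rewrite ler_wpM2r// dot_ge0.
have Wv t : T <= t -> kappa * dot (v t) (v t) <= W t.
  by move=> Tt; have [_ gap _] := near_T t Tt; exact: energy_ge gap.
pose B := expR (2 * k * T) * W T / kappa.
have B0 : 0 <= B.
  rewrite divr_ge0 ?(ltW kappa0)// mulr_ge0 ?expR_ge0//.
  by apply: le_trans (Wv T (lexx T)); rewrite mulr_ge0 ?dot_ge0// ltW.
exists (Num.sqrt B); first exact: sqrtr_ge0.
exists T => // t Tt.
rewrite exprMn sqr_sqrtr// expr2 -expRD -(ler_pM2l kappa0).
apply: le_trans (Wv t Tt) _; apply: le_trans (gronwall hW dWk Tt) _.
rewrite /B.
have -> : - (2 * k) * t = - k * t + - k * t by ring.
set A := expR _ * W T; set E := expR _.
by have -> : kappa * (A / kappa * E) = A * E by field; rewrite gt_eqF.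
Unshelve. all: by end_near. Qed.

Lemma position_decay (alpha k : R) (x v : R -> 'rV[R]_d) :
  0 < k < hb_rate mu alpha ->
  (forall t : R, 0 < t -> is_derive t 1 x (v t)) ->
  (forall t : R, 0 < t -> is_derive t 1 v (- (alpha *: v t) - grad f (x t))) ->
  x t @[t --> +oo] --> a ->
  exists2 D, 0 <= D & \forall t \near +oo, enorm (x t - a) <= D * expR (- k * t).
Proof.
move=> km hx hv xa; have /andP[k0 _] := km.
have [D D0 [T T0 vD]] := velocity_decay km hx hv xa.
have coord i t : T <= t -> `|x t ord0 i - a ord0 i| <= D / k * expR (- k * t).
  apply: (limit_dist_le (y := fun s => x s ord0 i) (dy := fun s => v s ord0 i)) => //.
  - by move=> s Ts; apply: is_derive_coord; apply: hx; exact: lt_le_trans Ts.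
  - move=> s Ts; apply: sqr_le_norm; first by rewrite mulr_ge0 ?expR_ge0.
    exact: le_trans (sqr_coord_le_dot _ _) (vD s Ts).
  - exact: (continuous_cvg _ (@coord_continuous _ _ _ ord0 i a) xa).
exists ((d%:R + 1) * (D / k)).
  by rewrite mulr_ge0 ?addr_ge0// divr_ge0// ltW.
near=> t.
have Tt : T <= t by near: t; apply: nbhs_pinfty_ge; exact: num_real.
have M0 : 0 <= D / k * expR (- k * t).
  by rewrite mulr_ge0 ?expR_ge0// divr_ge0// ltW.
rewrite -mulrA; set M := _ * expR _ in M0 coord *.
have dM0 : 0 <= (d%:R + 1) * M by rewrite mulr_ge0// addr_ge0.
rewrite -ler_sqr ?nnegrE ?enorm_ge0// enorm_sqr exprMn.
apply: (@le_trans _ _ (\sum_(i < d) M ^+ 2)).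
  apply: ler_sum => i _; rewrite -expr2 !mxE -(real_normK (num_real _)).
  by rewrite ler_sqr ?nnegrE ?normr_ge0//; exact: coord.
rewrite sumr_const card_ord -[leLHS]mulr_natl ler_wpM2r ?sqr_ge0//.
by have := ler0n R d; have := sqr_ge0 (d%:R : R); lra.
Unshelve. all: by end_near. Qed.

End PLMinimum.

Theorem theorem1p2 (R : realType) (d : nat) (f : 'rV[R]_d -> R) (mu L : R)
    (xs : 'rV[R]_d) (f_C1 : Ck_on 1 setT f) (mu_gt0 : 0 < mu) (L_gt0 : 0 < L)
    (xs_regular : regular_point mu L f xs) :
  (forall (alpha : R) (x0 v0 : 'rV[R]_d) (x v : R -> 'rV[R]_d),
     0 < alpha ->
     heavy_ball_solution alpha f x0 v0 x v ->
     (x t, v t) @[t --> +oo] --> (xs, (0 : 'rV[R]_d)) ->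
     forall eps : R, 0 < eps ->
       (expR ((hb_rate mu alpha - eps) * t) * enorm (x t - xs))
         @[t --> +oo] --> (0 : R) /\
       (expR (2 * (hb_rate mu alpha - eps) * t) * (f (x t) - f xs))
         @[t --> +oo] --> (0 : R)) /\
  [/\ 0 < 2 * Num.sqrt mu,
      (forall alpha : R, 0 < alpha ->
         hb_rate mu alpha <= hb_rate mu (2 * Num.sqrt mu)) &
      hb_rate mu (2 * Num.sqrt mu) = Num.sqrt mu].

Proof.
have q0 : 0 < Num.sqrt mu by rewrite sqrtr_gt0.
split; last first.
  split; [by rewrite mulr_gt0 | | exact: hb_rate_opt].
  by move=> alpha _; rewrite hb_rate_opt//; exact: hb_rate_le.
move=> alpha x0 v0 x v alpha0 [_ _ [hx _] [hv _]] xv eps eps0.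
have [gxs fmin [U [[oU Uxs] fU4 pl _]]] := xs_regular.
have fU : Ck_on 2 U f.
  case: fU4 => df hf; split=> // i; have [dpi hpi] := hf i; split=> // j.
  by have [dij _] := hpi j => y /dij; exact: differentiable_continuous.
have xxs : x t @[t --> +oo] --> xs by exact: (cvg_comp _ _ xv cvg_fst).
set m := hb_rate mu alpha.
have m0 : 0 < m by exact: hb_rate_gt0.
(* k is positive even when m - eps is not, as the decay lemmas require *)
pose k := Num.max (m / 2) (m - eps / 2).
have km : 0 < k < m by rewrite lt_max gt_max; apply/andP; split; [apply/orP; left|]; lra.
have mk : m - eps / 2 <= k by rewrite le_max lexx orbT.
have [D D0 xD] := position_decay oU Uxs fU gxs fmin mu_gt0 pl km hx hv xxs.
pose b := k - (m - eps).
have b0 : 0 < b by rewrite /b; lra.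
have rateE t : expR ((m - eps) * t) * expR (- k * t) = expR (- b * t).
  by rewrite -expRD /b; congr expR; ring.
split.
  apply: (@squeeze_cvgr _ _ _ _ (cst 0) (fun t => D * expR (- b * t))).
  - near=> t; rewrite mulr_ge0 ?expR_ge0 ?enorm_ge0//= -rateE mulrCA.
    by rewrite ler_wpM2l ?expR_ge0//; near: t.
  - exact: cvg_cst.
  - exact: cvg_expRN.
pose C := fro2 (hess f xs) + 2.
have C0 : 0 <= C by rewrite addr_ge0 ?fro2_ge0.
apply: (@squeeze_cvgr _ _ _ _ (cst 0) (fun t => C * D ^+ 2 * expR (- (2 * b) * t))).
- near=> t.
  have f_ge : f xs <= f (x t) by near: t; exact: (xxs _ fmin).
  have f_le : f (x t) - f xs <= C * dot (x t - xs) (x t - xs).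
    by near: t; exact: (xxs _ (quadratic_upper_bound oU Uxs fU gxs)).
  have x_le : enorm (x t - xs) <= D * expR (- k * t) by near: t.
  rewrite mulr_ge0 ?expR_ge0 ?subr_ge0//=.
  have -> : - (2 * b) * t = - b * t + - b * t by ring.
  have -> : 2 * (m - eps) * t = (m - eps) * t + (m - eps) * t by ring.
  rewrite !expRD -!rateE; set E := expR ((m - eps) * t); set F := expR _.
  have -> : C * D ^+ 2 * (E * F * (E * F)) = E * E * (C * (D * F) ^+ 2) by ring.
  rewrite ler_wpM2l ?mulr_ge0 ?expR_ge0//; apply: le_trans f_le _.
  rewrite ler_wpM2l// -enorm_sqr ler_sqr ?nnegrE ?enorm_ge0//.
  by rewrite mulr_ge0 ?expR_ge0.
- exact: cvg_cst.
- by apply: cvg_expRN; rewrite mulr_gt0.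
Unshelve. all: by end_near. Qed.
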